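(* Let $n\ge 1$. The diameter of the Hurwitz graph $G_T(n)$ satisfies $$\binom{n-1}{2}\le \mathrm{diam}(G_T(n))\le \frac32\binom{n-1}{2}.$$
   Context: $S_n$ is the symmetric group on $\{1,\dots,n\}$, with product $(\pi\sigma)(i)=\pi(\sigma(i))$; $T$ is the set of all transpositions in $S_n$. Let $c=(1,2,\dots,n)$ be the $n$-cycle. $NC(n)=\{\pi\in S_n:\ \ell_T(\pi)+\ell_T(\pi^{-1}c)=\ell_T(c)\}$, where $\ell_T(\pi)$ is the minimal number of factors in an expression of $\pi$ as a product of transpositions, ordered by $\pi\le\sigma\iff \ell_T(\pi)+\ell_T(\pi^{-1}\sigma)=\ell_T(\sigma)$. $F_n$ is the set of maximal chains of $NC(n)$; it is identified with the set of words $(t_1,\dots,t_{n-1})$ of transpositions with $t_1t_2\cdots t_{n-1}=c$, the word corresponding to the chain $id<t_1<t_1t_2<\cdots<c$ (for $n=1$, $F_1$ consists of the empty word). The Hurwitz graph $G_T(n)$ is the undirected graph with vertex set $F_n$, where two chains are adjacent if they differ in exactly one element. Equivalently, two distinct words are adjacent iff one is obtained from the other by replacing, for some $1\le i\le n-2$, the consecutive letters $(t_i,t_{i+1})$ by either $(t_{i+1}^{t_i},t_i)$ or $(t_{i+1},t_i^{t_{i+1}})$, where $g^h=h^{-1}gh$. This graph is connected. For a finite connected graph $G=(V,E)$ with graph metric $d$, $\mathrm{diam}(G)=\max_{v,w\in V}d(v,w)$. *)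

(* Defs.v *)
From HB Require Import structures.
From mathcomp Require Import all_boot all_order all_algebra all_fingroup.

Set Implicit Arguments.
Unset Strict Implicit.
Unset Printing Implicit Defensive.

Import GroupScope.

Section Graph.
Variables (V : finType) (e : rel V).

Definition has_walk (x y : V) (k : nat) : bool :=
  [exists p : k.-tuple V, path e x p && (last x p == y)].

(* The least k < #|V| such that a walk with k edges joins x to y. A shortest
   walk has fewer than #|V| edges, so the value is #|V| exactly when x and y
   lie in different components. *)
Definition gdist (x y : V) : nat := find (has_walk x y) (iota 0 #|V|).

Definition gdiam : nat := \max_(x : V) \max_(y : V) gdist x y.

End Graph.

Section Hurwitz.
Variable n : nat.
Implicit Types p q s t : 'S_n.

(* Functional composition, (pmul p q) i = p (q i); the product of 'S_n in the
   library composes in the opposite order. *)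
Definition pmul p q : 'S_n := q * p.

Lemma pmulE p q i : pmul p q i = p (q i).
Proof. exact: permM. Qed.

Definition transposition t : bool :=
  [exists i, exists j, (i != j) && (t == tperm i j)].

Definition transp_factorization s (k : nat) : bool :=
  [exists w : k.-tuple 'S_n,
     all transposition w && (\big[pmul/1]_(t <- w) t == s)].

Lemma transp_factorization_exists s : exists k, transp_factorization s k.
Proof.
have [ts es dts] := prod_tpermP s^-1.
pose w := [seq tperm u.1 u.2 | u <- ts].
exists (size w); apply/existsP; exists (in_tuple w); apply/andP; split.
  rewrite /= all_map; apply/allP => u uts /=.
  apply/existsP; exists u.1; apply/existsP; exists u.2.
  by rewrite eqxx andbT; exact: (allP dts).
rewrite /= -[s]invgK {}es /w; elim: ts {dts w} => [|u ts IHts] /=.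
  by rewrite !big_nil invg1.
by rewrite !big_cons invMg tpermV /pmul (eqP IHts).
Qed.

Definition ellT s : nat := ex_minn (transp_factorization_exists s).

(* The points 1, ..., n are encoded as 0, ..., n - 1 in 'I_n, and ordS sends i
   to i + 1 modulo n. *)
Definition cycle_perm : 'S_n := perm (can_inj (@ordSK n)).

Definition nc_le p q : bool := ellT p + ellT (pmul p^-1 q) == ellT q.

Definition NC : {set 'S_n} :=
  [set p | ellT p + ellT (pmul p^-1 cycle_perm) == ellT cycle_perm].

Definition nc_chain (C : {set 'S_n}) : bool :=
  (C \subset NC) && [forall p in C, forall q in C, nc_le p q || nc_le q p].

Definition max_chains : {set {set 'S_n}} := [set C | maxset nc_chain C].

Definition hurwitz_vertex : finType := {C : {set 'S_n} | C \in max_chains}.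

(* Maximal chains of NC all have n elements, so "differing in exactly one
   element" means that each chain has exactly one element not in the other. *)
Definition hurwitz_adj : rel hurwitz_vertex := fun C D =>
  (#|val C :\: val D| == 1%N) && (#|val D :\: val C| == 1%N).

End Hurwitz.

Arguments hurwitz_adj : clear implicits.

(* Main.v *)
Require Import Defs.
From mathcomp Require Import all_boot all_order all_algebra all_fingroup.
From mathcomp Require Import zify.

(** A maximal chain of non-crossing partitions is the same thing as a minimal
factorization of the long cycle c into transpositions. Words are multiplied
from left to right, the first letter acting first, so the chain of a word w is
the set of products of the suffixes of w. Replacing two consecutive letters of
w by two others with the same product is called a move; it changes at most one
element of the chain, so a sequence of k moves gives a walk of length at most k
in the Hurwitz graph.

Upper bound. Let u and v be two minimal factorizations, of length m, of the
same cycle p, and let i be a point of that cycle. The first letter of u that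
displaces i can be pushed to the end of u, one move per letter passed: a letter
that displaces i is conjugated by the travelling one, and any other letter
conjugates the travelling one. The travelling letter thus keeps displacing i,
and it arrives as the transposition (i, p i), which depends only on i and p
([move_to_end]). Doing this in v too, the two words get the same last letter,
and what precedes it are two factorizations of a cycle that is shorter by one.
Symmetrically, the last letters that displace i can be pushed to the front,
where they arrive as (i, p^-1 i) in both words ([move_to_front]). If F and L
are the positions of the first and last letter that displace i, counted from 0,
these pushes cost m - 1 - F and L, in total m - 1 + (L - F). Twice L - F is at most the sum of |2k + 1 - m| over
the positions k of the letters that displace i, because two distinct positions
contribute at least this much; as a letter displaces two points, summing over i
gives at most m^2 ([sum_touches]). The cycle has more than m points, so one of
the options (a point, and an end of the word) costs at most 3(m - 1)/2 for u
and v together ([cheap_meeting]), and the sum over m is 3/2 'C(m, 2)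
([moves_bound]).

Lower bound. Let [nonmin p] be the set of the points that are not the least
element of their p-cycle. It has as many elements as the reflection length of p
and grows along a chain, one point at a time, so that a maximal chain orders
the points other than 0. This is the permutation that an edge labelling of the
lattice attaches to the chain. Changing one element of the chain either
preserves this order or swaps two consecutive points, so the number of
inversions changes by at most one ([card_inversionsD]). Cycles on initial
segments give the increasing order, cycles on final segments the decreasing
one, and these two chains are at distance at least 'C(n - 1, 2). *)

Set Implicit Arguments.
Unset Strict Implicit.
Unset Printing Implicit Defensive.

Import GroupScope.

(** * Reflection length *)

Notation wprod w := (\prod_(t <- w) t).

Section ReflectionLength.
Variable T : finType.
Implicit Types (p q s t : {perm T}) (u v w : seq {perm T}) (x y : T).

(** [transposition] over any finite type; on 'S_n the two are convertible. *)
Definition is_tperm t := [exists x, exists y, (x != y) && (t == tperm x y)].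

Lemma is_tpermP t : reflect (exists x y, x != y /\ t = tperm x y) (is_tperm t).
Proof.
apply: (iffP existsP) => [[x /existsP[y /andP[xy /eqP->]]]|[x [y [xy ->]]]].
  by exists x, y.
by exists x; apply/existsP; exists y; rewrite xy eqxx.
Qed.

Lemma is_tperm_tperm x y : x != y -> is_tperm (tperm x y).
Proof. by move=> xy; apply/is_tpermP; exists x, y. Qed.

Lemma is_tpermE t x : is_tperm t -> t x != x -> t = tperm x (t x).
Proof.
case/is_tpermP=> a [b [ab ->]]; case: tpermP => [->|->|_ _] //.
- by rewrite tpermC.
- by rewrite eqxx.
Qed.

Lemma is_tpermV t : is_tperm t -> t^-1 = t.
Proof. by case/is_tpermP=> a [b [_ ->]]; rewrite tpermV. Qed.

Lemma is_tpermJ t p : is_tperm t -> is_tperm (t ^ p).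
Proof.
case/is_tpermP=> a [b [ab ->]]; rewrite tpermJ; apply: is_tperm_tperm.
by rewrite (inj_eq perm_inj).
Qed.

Lemma porbit_fix p x : p x = x -> porbit p x = [set x].
Proof.
move=> px; apply/setP=> y; rewrite inE; apply/porbitP/eqP=> [[k ->]|->].
  by rewrite permX_fix.
by exists 0; rewrite perm1.
Qed.

Lemma perm_porbit p x : p x \in porbit p x.
Proof. by rewrite -{1}[p]expg1 mem_porbit. Qed.

(** The reflection length in closed form, as an alternative to the least size
of a factorization; [ellT_rlen] identifies the two. *)
Definition rlen p := #|T| - #|porbits p|.

Lemma porbits_le p : #|porbits p| <= #|T|.
Proof. by rewrite /porbits leq_imset_card. Qed.

Lemma rlen_porbits p : rlen p + #|porbits p| = #|T|.
Proof. by rewrite subnK ?porbits_le. Qed.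

Lemma rlen1 : rlen 1 = 0.
Proof.
rewrite /rlen [#|porbits _|]card_imset ?cardE ?subnn // => x y.
by rewrite !porbit_fix ?perm1 //; apply: set1_inj.
Qed.

Lemma rlen_eq0 p : (rlen p == 0) = (p == 1).
Proof.
apply/idP/eqP=> [|->]; last by rewrite rlen1.
move=> e; apply/permP=> x; rewrite perm1.
have : #|porbits p| == #|T|.
  by have := rlen_porbits p; rewrite (eqP e) add0n => ->.
move/imset_injP=> inj.
apply: inj; rewrite ?inE //; apply/eqP; rewrite eq_porbit_mem.
exact: perm_porbit.
Qed.

Lemma rlenV p : rlen p^-1 = rlen p.
Proof. by rewrite /rlen porbitsV. Qed.

(** Multiplying by a transposition cuts a cycle in two if it contains both
points, and otherwise glues two cycles. *)
Lemma rlen_tpermM x y p : x != y ->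
  (rlen (tperm x y * p)).+1 = rlen p + (x \notin porbit p y).*2.
Proof.
move=> xy; have := porbits_mul_tperm p x y; rewrite /= xy.
move: (rlen_porbits p) (rlen_porbits (tperm x y * p)).
move: #|porbits _| (rlen _) #|porbits p| (rlen p) #|T|.
by case: (_ \notin _) => /=; lia.
Qed.

Lemma rlen_word w : all is_tperm w -> rlen (wprod w) <= size w.
Proof.
elim: w => [|t w IH] /=; first by rewrite big_nil rlen1.
case/andP=> /is_tpermP[x [y [xy ->]]] /IH; rewrite big_cons.
by have := rlen_tpermM (wprod w) xy; case: (_ \notin _) => /=; lia.
Qed.

Definition reduced w := all is_tperm w && (rlen (wprod w) == size w).

Lemma rlen_cut p x y : x != y -> x \in porbit p y ->
  rlen p = (rlen (tperm x y * p)).+1.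
Proof. by move=> xy xpy; rewrite rlen_tpermM // xpy addn0. Qed.

(** Cutting x off the cycle of p for a displaced x lowers the reflection length
by one, so repeating this reaches the identity in [rlen p] steps. *)
Lemma reduced_wordP p : exists2 w, reduced w & wprod w = p.
Proof.
elim: {p}(rlen p) {-2}p (erefl (rlen p)) => [|k IH] p.
  move/eqP; rewrite rlen_eq0 => /eqP->.
  by exists [::]; rewrite /reduced ?big_nil ?rlen1.
move=> pk; have [x px] : exists x, p x != x.
  apply/existsP; apply: contra_eqT pk => /existsPn h.
  suff -> : p = 1 by rewrite rlen1.
  by apply/permP=> x; rewrite perm1; apply/eqP; rewrite -[_ == _]negbK.
have xpx : x != p x by rewrite eq_sym.
have len : rlen p = (rlen (tperm x (p x) * p)).+1.
  by apply: rlen_cut; rewrite // porbit_sym perm_porbit.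
have [|w /andP[wT /eqP wl] wp] := IH (tperm x (p x) * p).
  by apply/eqP; rewrite -eqSS -len pk.
exists (tperm x (p x) :: w); last by rewrite big_cons wp tpermKg.
rewrite /reduced /= wT is_tperm_tperm //= big_cons -wl wp tpermKg.
by rewrite -len.
Qed.

Lemma rlenM p q : rlen (p * q) <= rlen p + rlen q.
Proof.
have [u /andP[u1 /eqP u2] <-] := reduced_wordP p.
have [v /andP[v1 /eqP v2] <-] := reduced_wordP q.
by rewrite u2 v2 -big_cat -size_cat rlen_word // all_cat u1.
Qed.

Lemma reduced_cat u v : reduced (u ++ v) -> reduced u /\ reduced v.
Proof.
rewrite /reduced all_cat big_cat size_cat => /andP[/andP[u1 v1] /eqP /= e].
have := rlenM (wprod u) (wprod v); rewrite u1 v1 e /=.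
by move: (rlen_word u1) (rlen_word v1); move: (rlen _) (rlen _); lia.
Qed.

Lemma wprod_rev w : all is_tperm w -> wprod (rev w) = (wprod w)^-1.
Proof.
elim: w => [|t w IH] /=; first by rewrite !big_nil invg1.
case/andP=> tT /IH; rewrite rev_cons big_rcons big_cons invMg => -> /=.
by rewrite (is_tpermV tT).
Qed.

Lemma reduced_rev w : reduced (rev w) = reduced w.
Proof.
rewrite /reduced all_rev size_rev; case: (boolP (all _ w)) => //= wT.
by rewrite wprod_rev // rlenV.
Qed.

End ReflectionLength.

(** * Moves between factorizations *)

Section Moves.
Variable T : finType.
Implicit Types (p q s t : {perm T}) (u v w a b : seq {perm T}) (x y i : T).

(** Hurwitz moves replace the letters s, t by either t, t^-1 s t or
s t s^-1, s. Allowing any two transpositions with the same product also covers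
every change of a single element of a chain. *)
Inductive moves : nat -> seq {perm T} -> seq {perm T} -> Prop :=
| moves_refl w : moves 0 w w
| moves_step a b s t s' t' :
    all (@is_tperm T) [:: s; t; s'; t'] -> s * t = s' * t' ->
    moves 1 (a ++ [:: s, t & b]) (a ++ [:: s', t' & b])
| moves_trans j k u v w : moves j u v -> moves k v w -> moves (j + k) u w.

Lemma moves_ctx a b k u v : moves k u v -> moves k (a ++ u ++ b) (a ++ v ++ b).
Proof.
elim=> [w|a' b' s t s' t' tT e|j l u' v' w _ IH1 _ IH2].
- exact: moves_refl.
- rewrite -!catA !cat_cons ![a ++ _ ++ _]catA; exact: moves_step.
- exact: moves_trans IH1 IH2.
Qed.

Lemma moves_sym k u v : moves k u v -> moves k v u.
Proof.
elim=> [w|a' b' s t s' t' tT e|j l u' v' w _ IH1 _ IH2].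
- exact: moves_refl.
- by apply: moves_step => //; move: tT => /= /and5P[-> -> -> ->].
- by rewrite addnC; apply: moves_trans IH2 IH1.
Qed.

Lemma moves_rev k u v : moves k u v -> moves k (rev u) (rev v).
Proof.
elim=> [w|a' b' s t s' t' tT e|j l u' v' w _ IH1 _ IH2].
- exact: moves_refl.
- rewrite !rev_cat !rev_cons -!cats1 -!catA /=; apply: moves_step.
    by move: tT => /= /and5P[-> -> -> ->].
  apply: invg_inj; rewrite !invMg.
  by move: tT => /= /and5P[/is_tpermV-> /is_tpermV-> /is_tpermV-> /is_tpermV-> _].
- exact: moves_trans IH1 IH2.
Qed.

Lemma moves_inv k u v : moves k u v ->
  [/\ size v = size u, wprod v = wprod u
    & all (@is_tperm T) v = all (@is_tperm T) u].
Proof.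
elim=> [w|a' b' s t s' t' tT e|j l u' v' w _ [-> -> ->] _ [-> -> ->]] //.
rewrite !size_cat !big_cat !big_cons !all_cat /= ![_ * (_ * wprod b')]mulgA e.
by split=> //; move: tT => /= /and5P[-> -> -> ->].
Qed.

Lemma moves_reduced k u v : moves k u v -> reduced v = reduced u.
Proof. by case/moves_inv; rewrite /reduced => -> -> ->. Qed.

(** The travelling letter (i r) passes s in one move. If s fixes i, it is the
travelling letter that gets conjugated, and it becomes (i, s r). If s displaces
i, then s gets conjugated instead; here r = s r because s is not (i r) itself,
as two equal adjacent letters would cancel. Either way r follows the action of
the word. *)
Lemma move_right b i r : i != r -> reduced (tperm i r :: b) ->
  exists b', moves (size b) (tperm i r :: b) (rcons b' (tperm i (wprod b r))).
Proof.
elim: b r => [|s b IH] r ir red.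
  by exists [::]; rewrite big_nil perm1; apply: moves_refl.
have [_ redb] := reduced_cat (u := [::_]) red.
have sT : is_tperm s by case/andP: redb => /andP[].
have [si|si] := eqVneq (s i) i.
  have tsE : tperm i r * s = s * tperm i (s r) by rewrite -{2}si -tpermJ -conjgC.
  have isr : i != s r by rewrite -{1}si (inj_eq perm_inj).
  have step : moves 1 [:: tperm i r, s & b] [:: s, tperm i (s r) & b].
    by apply: (moves_step [::]) => //=; rewrite sT !is_tperm_tperm.
  have [|b' mb] := IH (s r) isr.
    have := moves_reduced step; rewrite red => /(reduced_cat (u := [::_]))[] //.
  exists (s :: b'); rewrite big_cons permM.
  rewrite -[size _]add1n; apply: moves_trans step _.
  by have := moves_ctx [:: s] [::] mb; rewrite !cats0.
have sE : s = tperm i (s i) by apply: is_tpermE.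
have rsi : r != s i.
  apply/eqP=> rE; move: red; rewrite rE -sE => /andP[/and3P[_ _ bT]].
  rewrite !big_cons -{1}(is_tpermV sT) mulKg.
  by have := rlen_word bT; move: (rlen _) => /=; lia.
have rs : s r = r by rewrite sE tpermD // 1?eq_sym.
have step : moves 1 [:: tperm i r, s & b] [:: s ^ (tperm i r)^-1, tperm i r & b].
  apply: (moves_step [::]) => //=; last by rewrite -conjgCV.
  by rewrite sT is_tpermJ // !is_tperm_tperm.
have [|b' mb] := IH r ir.
  have := moves_reduced step; rewrite red => /(reduced_cat (u := [::_]))[] //.
exists (s ^ (tperm i r)^-1 :: b'); rewrite big_cons permM rs.
rewrite -[size _]add1n; apply: moves_trans step _.
by have := moves_ctx [:: s ^ (tperm i r)^-1] [::] mb; rewrite !cats0.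
Qed.

Definition first_touch i w := find (fun t => t i != i) w.

Lemma wprod_touch w i : wprod w i != i -> has (fun t => t i != i) w.
Proof.
apply: contraR => /hasPn h; apply/eqP; elim: w h => [|t w IH] h.
  by rewrite big_nil perm1.
have /eqP ti : t i == i by rewrite -[_ == _]negbK h ?mem_head.
by rewrite big_cons permM ti IH // => t' tw; rewrite h // inE tw orbT.
Qed.

(** The letters before the first one that displaces i fix i, hence the
travelling letter, which starts as (i, t i), arrives as (i, p i) for p the
product of the whole word. *)
Lemma move_to_end w i : reduced w -> wprod w i != i ->
  exists w', moves (size w - (first_touch i w).+1) w
                   (rcons w' (tperm i (wprod w i))).
Proof.
move=> red /wprod_touch; rewrite /first_touch.
elim: w red => [|t w IH] //= red; have [_ redw] := reduced_cat (u := [::_]) red.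
have [ti|ti _] := eqVneq (t i) i => /=.
  case/IH=> // w' mw; exists (t :: w'); rewrite big_cons permM ti subSS.
  by have := moves_ctx [:: t] [::] mw; rewrite !cats0.
have tE : t = tperm i (t i) by apply: is_tpermE => //; case/andP: red => /andP[].
rewrite subn1 big_cons permM /=.
have := @move_right w i (t i); rewrite -tE eq_sym => /(_ ti red) [w' mw].
by exists w'.
Qed.

(** Reversing a word of transpositions inverts its product, which exchanges the
two ends. *)
Lemma move_to_front w i : reduced w -> wprod w i != i ->
  exists w', moves (size w - (first_touch i (rev w)).+1) w
                   (tperm i ((wprod w)^-1 i) :: w').
Proof.
move=> red wi; have wT := andP red; have [||w' mw] := @move_to_end (rev w) i.
- by rewrite reduced_rev.
- by rewrite wprod_rev 1?(canF_eq (permKV _)) 1?eq_sym //; case: wT.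
exists (rev w'); move/moves_rev: mw; rewrite revK rev_rcons size_rev.
by rewrite wprod_rev //; case: wT.
Qed.

End Moves.

(** * Meeting at a common letter *)

(** The absolute value |2k + 1 - m| in truncated arithmetic: twice the distance
of position k to the middle of a word of length m. *)
Definition centre_dist m k := (k.*2.+1 - m) + (m - k.*2.+1).

(** Removing both end positions shifts the middle by one, which allows an
induction in steps of two. *)
Lemma sum_centre_dist m : (\sum_(k < m) centre_dist m k).*2 <= m ^ 2.
Proof.
elim/ltn_ind: m => [[|[|m]]] IH; first by rewrite big_ord0.
  by rewrite big_ord_recl big_ord0.
rewrite big_ord_recr big_ord_recl /=.
have -> : \sum_(i < m) centre_dist m.+2 (bump 0 i)
        = \sum_(i < m) centre_dist m i.
  by apply: eq_bigr => i _; rewrite /centre_dist /bump /=; lia.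
have := IH m (leqW (leqnn _)); move: (\sum_(_ < _) _) => S.
by rewrite /centre_dist !expnS !expn0; lia.
Qed.

Section Bound.
Variable T : finType.
Implicit Types (p q s t : {perm T}) (u v w a b : seq {perm T}) (x y i : T).

Definition touches (w : seq {perm T}) i k : bool := nth 1 w k i != i.

(** L is the position of the last letter of w that displaces i. *)
Lemma first_touch_rev w i : wprod w i != i ->
  let L := size w - (first_touch i (rev w)).+1 in
  [/\ first_touch i w <= L, L < size w, touches w i (first_touch i w)
    & touches w i L].
Proof.
move=> wi; have hw := wprod_touch wi.
have hr : has (fun t => t i != i) (rev w) by rewrite has_rev.
have := hw; have := hr; rewrite !has_find size_rev => lr lw L.
have L_touch : touches w i L.
  by rewrite /touches -nth_rev //; have := nth_find 1 hr.
have Lw : L < size w by rewrite /L /first_touch; lia.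
split=> //; last by have := nth_find 1 hw.
rewrite leqNgt; apply/negP=> /(before_find 1).
by rewrite -/(touches w i L) L_touch.
Qed.

(** The number of letters after the first one that displaces i, which is what
[move_to_end] costs. The cost of [move_to_front] is [end_cost (rev w) i]. *)
Definition end_cost w i := size w - (first_touch i w).+1.

(** The two costs add up to m - 1 plus the distance between the first and the
last letter that displace i. If these letters differ, their two terms in the
sum already account for twice that distance. *)
Lemma cost_touch w i : wprod w i != i ->
  (end_cost w i + end_cost (rev w) i).*2
  <= (size w).-1.*2 + \sum_(k < size w) touches w i k * centre_dist (size w) k.
Proof.
rewrite /end_cost size_rev => /first_touch_rev /=.
set L := _ - _.+1; set F := first_touch i w.
case=> FL Lw tF tL.
have Fw := leq_ltn_trans FL Lw.
rewrite (bigD1 (Ordinal Lw)) //= tL mul1n.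
have [e|ne] := eqVneq F L; first by rewrite e; lia.
rewrite (bigD1 (Ordinal Fw)) /= ?tF; last by rewrite -val_eqE.
by move: (\sum_(_ < _ | _) _) => S; rewrite /centre_dist; lia.
Qed.

Lemma card_moved_tperm t (A : {set T}) : is_tperm t ->
  \sum_(i in A) (t i != i) <= 2.
Proof.
case/is_tpermP=> x [y [xy ->]].
rewrite -big_mkcondr sum1_card.
apply: leq_trans (_ : #|[set x; y]| <= _); last by rewrite cards2 xy.
apply: subset_leq_card; apply/subsetP=> z; rewrite !inE => /andP[_].
by case: tpermP => [->|->|]; rewrite ?eqxx ?orbT.
Qed.

Lemma sum_touches w (A : {set T}) : all (@is_tperm T) w ->
  \sum_(i in A) \sum_(k < size w) touches w i k * centre_dist (size w) k
    <= size w ^ 2.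
Proof.
move=> /all_nthP wT; rewrite exchange_big /=.
apply: leq_trans (sum_centre_dist _); rewrite -mul2n big_distrr /=.
apply: leq_sum => k _; rewrite -big_distrl leq_mul2r; apply/orP; right.
exact: card_moved_tperm (wT 1 k (ltn_ord k)).
Qed.

(** The cycle of a displaced point and the fixed points are distinct cycles,
which bounds the number of cycles from below. *)
Lemma card_support p : p != 1 -> rlen p < #|[set x | p x != x]|.
Proof.
move=> p1; have [x px] : exists x, p x != x.
  apply/existsP; apply: contraR p1 => /existsPn h.
  by apply/eqP/permP=> x; rewrite perm1; apply/eqP; rewrite -[_ == _]negbK.
set A := [set x | p x != x].
pose U := porbit p x |: [set [set y] | y in ~: A].
have sU : U \subset porbits p.
  apply/subsetP=> B; rewrite !inE => /orP[/eqP->|/imsetP[y]]; first exact: imset_f.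
  rewrite !inE negbK => /eqP py ->; rewrite -(porbit_fix py); exact: imset_f.
have := subset_leq_card sU; rewrite cardsU1 card_imset; last exact: set1_inj.
rewrite (_ : _ \notin _); last first.
  apply/imsetP=> -[y _ e]; have := porbit_id p x; have := perm_porbit p x.
  by rewrite e !inE => /eqP px' /eqP xx; rewrite px' -xx eqxx in px.
have := cardsC A; have := rlen_porbits p.
move: #|porbits p| (rlen p) #|A| #|~: A| #|T|.
by move=> /=; lia.
Qed.

(** At most one cycle is not a fixed point; the identity qualifies, so that the
induction in [moves_bound] can end with the empty word. *)
Definition one_cycle p := forall x y, p x != x -> p y != y -> y \in porbit p x.

Lemma one_cycleV p : one_cycle p -> one_cycle p^-1.
Proof.
move=> cp x y px py; rewrite porbitV; apply: cp.
  by apply: contraNneq px => e; rewrite -{1}e permK.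
by apply: contraNneq py => e; rewrite -{1}e permK.
Qed.

(** The new permutation fixes i and otherwise follows the cycle of p, jumping
over i. *)
Lemma one_cycle_cut p i :
  one_cycle p -> p i != i -> one_cycle (p * tperm i (p i)).
Proof.
move=> cp pi; set q := p * _.
have qE x : q x = tperm i (p i) (p x) by rewrite permM.
(* Along the p-orbit of i, every point other than i is in the q-orbit
   of p i. *)
have orb k : (p ^+ k) i = i \/ (p ^+ k) i \in porbit q (p i).
  elim: k => [|k IH]; first by left; rewrite perm1.
  rewrite expgSr permM; move: IH; set y := (p ^+ k) i => IH.
  have [->|yi] := eqVneq y i; first by right; rewrite porbit_id.
  have [->|pyi] := eqVneq (p y) i; first by left.
  case: IH => [e|yq]; first by rewrite e eqxx in yi.
  have qy : q y = p y.
    by rewrite qE tpermD // 1?eq_sym // (inj_eq perm_inj).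
  right; rewrite -qy -eq_porbit_mem (_ : porbit q (q y) = porbit q y).
    by rewrite eq_porbit_mem.
  by apply/eqP; rewrite eq_porbit_mem perm_porbit.
have qi : q i = i by rewrite qE tpermR.
have main x : q x != x -> x \in porbit q (p i).
  move=> qx; have xi : x != i by apply: contraNneq qx => ->; rewrite qi.
  have px : p x != x.
    apply: contraNneq qx => e; rewrite qE e tpermD // 1?eq_sym //.
    by apply: contraNneq xi => e2; apply/eqP/(perm_inj (s := p)); rewrite -e2 e.
  have /porbitP[k xE] := cp i x pi px.
  by case: (orb k); rewrite -xE // => e; rewrite e eqxx in xi.
move=> x y /main xq /main yq; move: xq yq.
by rewrite -!eq_porbit_mem => /eqP-> .
Qed.

(** If every option cost more, the four costs at each point of the cycle would
add up to at least 3(m - 1) + 1, while their sum over the points is bounded by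
[sum_touches]. This forces the cycle to have at most m points, against
[card_support]. *)
Lemma cheap_meeting u v : reduced u -> reduced v -> wprod v = wprod u ->
  wprod u != 1 ->
  exists2 i, wprod u i != i &
    (end_cost u i + end_cost v i).*2 <= 3 * (size u).-1 \/
    (end_cost (rev u) i + end_cost (rev v) i).*2 <= 3 * (size u).-1.
Proof.
move=> /andP[uT /eqP ul] /andP[vT /eqP vl] vu u1.
have m_gt0 : 0 < size u by rewrite -ul lt0n rlen_eq0.
have sv : size v = size u by rewrite -vl vu ul.
set A := [set x | wprod u x != x]; have := card_support u1; rewrite ul -/A => mA.
pose cheap i := ((end_cost u i + end_cost v i).*2 <= 3 * (size u).-1)
  || ((end_cost (rev u) i + end_cost (rev v) i).*2 <= 3 * (size u).-1).
have [/existsP[i /andP[]]|/existsPn none] := boolP [exists i, (i \in A) && cheap i].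
  by rewrite inE => iA /orP ic; exists i.
pose weight w i := \sum_(k < size w) touches w i k * centre_dist (size w) k.
have expensive i : i \in A -> (size u).*2 <= weight u i + weight v i.
  move=> iA; have := none i; rewrite iA /= negb_or -!ltnNge.
  move: iA; rewrite inE => ui; have := cost_touch ui.
  have := @cost_touch v i; rewrite vu => /(_ ui).
  rewrite -/(weight u i) -/(weight v i) sv; move: (weight u i) (weight v i).
  by move: (end_cost _ _) (end_cost _ _) (end_cost _ _) (end_cost _ _); lia.
have : \sum_(i in A) (size u).*2 <= \sum_(i in A) (weight u i + weight v i).
  exact: leq_sum.
rewrite sum_nat_const big_split /=.
have hu : \sum_(i in A) weight u i <= size u ^ 2 := sum_touches A uT.
have hv : \sum_(i in A) weight v i <= size u ^ 2 by rewrite -sv; apply: sum_touches.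
move/leq_trans=> /(_ _ (leq_add hu hv)).
by move: m_gt0 mA; move: #|A| (size u) => a m; rewrite !expnS expn0; nia.
Qed.

(** After a cheap meeting, the words without their common letter factor a cycle
that is shorter by one, and 3(m - 1)/2 is the m-th increment of the bound. *)
Lemma moves_bound u v : one_cycle (wprod u) -> reduced u -> reduced v ->
  wprod v = wprod u ->
  exists2 k, moves k u v & 4 * k <= 3 * (size u * (size u).-1).
Proof.
elim: {u}(size u) {-2}u v (erefl (size u)) => [|m IH] u v um cu ru rv vu.
  have sv : size v = 0.
    by case/andP: rv => _ /eqP<-; case/andP: ru => _ /eqP; rewrite vu um => ->.
  rewrite (size0nil um) (size0nil sv); exists 0 => //; exact: moves_refl.
have u1 : wprod u != 1.
  by case/andP: ru => _; rewrite -rlen_eq0 um => /eqP->.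
have arith j k : j.*2 <= 3 * m -> 4 * k <= 3 * (m * m.-1) ->
    4 * (j + k) <= 3 * (m.+1 * m).
  by case: m {IH um} => [|m] /=; nia.
rewrite um /=; have [i ui] := cheap_meeting ru rv vu u1; rewrite um.
have vi : wprod v i != i by rewrite vu.
case=> cost.
- have [u' mu] := move_to_end ru ui; have [v' mv] := move_to_end rv vi.
  rewrite vu in mv; set t := tperm i (wprod u i) in mu mv.
  have [su pu _] := moves_inv mu; have [_ pv _] := moves_inv mv.
  have [|ru' _] := @reduced_cat _ u' [:: t]; first by rewrite cats1 (moves_reduced mu).
  have [|rv' _] := @reduced_cat _ v' [:: t]; first by rewrite cats1 (moves_reduced mv).
  have su' : size u' = m by move: su; rewrite size_rcons um => -[].
  have pu' : wprod u' = wprod u * t by rewrite -pu big_rcons /= -mulgA tperm2 mulg1.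
  have pv' : wprod v' = wprod u'.
    by rewrite pu' -vu -pv big_rcons /= -mulgA tperm2 mulg1.
  have [|k mk ck] := IH u' v' su' _ ru' rv' pv'.
    by rewrite pu'; apply: one_cycle_cut.
  rewrite su' in ck.
  exists (end_cost u i + end_cost v i + k); last exact: arith.
  rewrite addnAC; apply: moves_trans (moves_sym mv).
  apply: moves_trans mu _; rewrite -!cats1; exact: (moves_ctx [::] _ mk).
- have [u' mu] := move_to_front ru ui; have [v' mv] := move_to_front rv vi.
  rewrite vu in mv; set t := tperm i ((wprod u)^-1 i) in mu mv.
  have [su pu _] := moves_inv mu; have [_ pv _] := moves_inv mv.
  have [|_ ru'] := @reduced_cat _ [:: t] u'; first by rewrite (moves_reduced mu).
  have [|_ rv'] := @reduced_cat _ [:: t] v'; first by rewrite (moves_reduced mv).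
  have su' : size u' = m by move: su; rewrite /= um => -[].
  have pu' : wprod u' = t * wprod u by rewrite -pu big_cons tpermKg.
  have pv' : wprod v' = wprod u' by rewrite pu' -vu -pv big_cons tpermKg.
  have [|k mk ck] := IH u' v' su' _ ru' rv' pv'.
    rewrite -[wprod u']invgK pu' invMg tpermV; apply: one_cycleV.
    apply: one_cycle_cut; first exact: one_cycleV.
    by apply: contraNneq ui => e; rewrite -{1}e permKV.
  rewrite su' in ck.
  exists (end_cost (rev u) i + end_cost (rev v) i + k); last exact: arith.
  rewrite addnAC /end_cost !size_rev; apply: moves_trans (moves_sym mv).
  by apply: moves_trans mu _; have := moves_ctx [:: t] [::] mk; rewrite !cats0.
Qed.

End Bound.

(** * Maximal chains and factorizations of the long cycle *)

Section Chains.
Variable n : nat.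
Implicit Types (p q s t : 'S_n) (u v w a b : seq 'S_n) (C D : {set 'S_n}).

Notation c := (cycle_perm n).

(** The product [pmul] composes functions, whereas the library multiplies from
left to right; hence the reversal. *)
Lemma big_pmul w : \big[@pmul n/1]_(t <- w) t = wprod (rev w).
Proof.
elim: w => [|t w IH]; first by rewrite !big_nil.
by rewrite big_cons IH rev_cons big_rcons.
Qed.

Lemma ellT_rlen p : ellT p = rlen p.
Proof.
rewrite /ellT; case: ex_minnP => k /existsP[x /andP[xT /eqP xp]] kmin.
have [w /andP[wT /eqP wl] wp] := reduced_wordP p.
apply/eqP; rewrite eqn_leq -{1}wp wl; apply/andP; split.
  apply: kmin; apply/existsP; rewrite -size_rev; exists (in_tuple (rev w)).
  by rewrite /= all_rev [all _ _]wT big_pmul revK wp eqxx.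
by have := @rlen_word _ (rev x); rewrite -big_pmul xp size_rev size_tuple all_rev => ->.
Qed.

Lemma nc_leE p q : nc_le p q = (rlen p + rlen (q * p^-1) == rlen q).
Proof. by rewrite /nc_le !ellT_rlen. Qed.

Lemma NC_E p : (p \in NC n) = nc_le p c.
Proof. by rewrite inE. Qed.

Lemma nc_lexx p : nc_le p p.
Proof. by rewrite nc_leE mulgV rlen1 addn0. Qed.

Lemma nc_le_suffix u v : reduced (u ++ v) -> nc_le (wprod v) (wprod (u ++ v)).
Proof.
move=> r; have [/andP[_ /eqP ru] /andP[_ /eqP rv]] := reduced_cat r.
case/andP: r => _ /eqP r.
by rewrite nc_leE r big_cat /= mulgK size_cat ru rv addnC.
Qed.

Lemma nc_leP p q : nc_le p q ->
  exists u v, [/\ reduced (u ++ v), wprod v = p & wprod (u ++ v) = q].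
Proof.
rewrite nc_leE => /eqP e.
have [u /andP[uT /eqP ul] pu] := reduced_wordP (q * p^-1).
have [v /andP[vT /eqP vl] pv] := reduced_wordP p.
have pw : wprod (u ++ v) = q by rewrite big_cat /= pu pv mulgKV.
exists u, v; split=> //.
by rewrite /reduced all_cat uT vT pw size_cat -ul -vl pu pv addnC e eqxx.
Qed.

Lemma nc_le_rlen p q : nc_le p q -> rlen p <= rlen q.
Proof. by rewrite nc_leE => /eqP<-; apply: leq_addr. Qed.

Lemma nc_le_eq p q : nc_le p q -> rlen q <= rlen p -> p = q.
Proof.
rewrite nc_leE => /eqP<-; rewrite -{2}[rlen p]addn0 leq_add2l leqn0 rlen_eq0.
by move/eqP=> e; rewrite -[q](mulgKV p) e mul1g.
Qed.

(** Suffixes take the role of the prefixes in t_1 < t_1 t_2 < ..., because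
[pmul] composes functions: t_1 is the last letter here. *)
Fixpoint chain w : {set 'S_n} :=
  if w is _ :: w' then wprod w |: chain w' else [set 1].

Lemma chainP w p :
  reflect (exists a b, w = a ++ b /\ p = wprod b) (p \in chain w).
Proof.
apply: (iffP idP) => [|[a [b [-> ->]]]]; last first.
  elim: a => [|s a IH]; last by rewrite inE IH orbT.
  by case: b => [|s b]; rewrite !inE ?big_nil eqxx.
elim: w => [|s w IH] /=.
  by rewrite inE => /eqP->; exists [::], [::]; rewrite big_nil.
rewrite inE => /orP[/set1P->|/IH[a [b [-> ->]]]]; first by exists [::], (s :: w).
by exists (s :: a), b.
Qed.

Definition factorization w := reduced w && (wprod w == c).

Lemma suffix_rlen a b : reduced (a ++ b) -> rlen (wprod b) = size b.
Proof. by case/reduced_cat=> _ /andP[_ /eqP]. Qed.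

Lemma nc_chain_chain w : factorization w -> nc_chain (chain w).
Proof.
case/andP=> rw /eqP wc; apply/andP; split.
  apply/subsetP=> p /chainP[a [b [wE ->]]]; rewrite wE in rw wc.
  by rewrite NC_E -wc; apply: nc_le_suffix.
apply/forall_inP=> p /chainP[a [b [wE ->]]].
apply/forall_inP=> q /chainP[a' [b' [wE' ->]]].
wlog le_b : a b a' b' wE wE' / size b <= size b'.
  by move=> H; case: (leqP (size b) (size b')) => [|/ltnW] /H;
    [apply; eassumption | rewrite orbC; apply; eassumption].
have bE : b' = take (size b' - size b) b' ++ b.
  rewrite -{1}(cat_take_drop (size b' - size b) b'); congr (_ ++ _).
  have sz : size a' + size b' = size a + size b by rewrite -!size_cat -wE -wE'.
  transitivity (drop (size a) w); last by rewrite wE drop_size_cat.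
  rewrite wE' drop_cat; case: ltnP => [|_]; first lia.
  by congr drop; lia.
apply/orP; left; rewrite wE' in rw; have [_ rb'] := reduced_cat rw.
by rewrite bE; apply: nc_le_suffix; rewrite -bE.
Qed.

(** The chain of a word contains an element of every reflection length up to
the top, and comparable elements of the same length are equal. *)
Lemma chain_max w : factorization w -> chain w \in max_chains n.
Proof.
move=> fw; rewrite inE; apply/maxsetP.
split=> [|C /andP[/subsetP CN /forall_inP Cc] sC].
  exact: nc_chain_chain.
apply/eqP; rewrite eqEsubset sC andbT; apply/subsetP=> p pC.
case/andP: fw => rw /eqP wc.
have pl : rlen p <= size w.
  have := CN p pC; rewrite NC_E => /nc_le_rlen; rewrite -wc.
  by case/andP: rw => _ /eqP->.
pose k := size w - rlen p.
have wE : w = take k w ++ drop k w by rewrite cat_take_drop.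
have ql : rlen (wprod (drop k w)) = rlen p.
  by rewrite (@suffix_rlen (take k w)) ?cat_take_drop // size_drop subKn.
have qC : wprod (drop k w) \in chain w.
  by apply/chainP; exists (take k w), (drop k w).
have /forall_inP/(_ _ (subsetP sC _ qC))/orP[] := Cc p pC => /nc_le_eq.
  by move=> ->; rewrite // ql.
by move=> <-; rewrite // ql.
Qed.

(** The largest element p of C below q comes from a suffix, by induction, and
any reduced word of the remaining factor of q completes it. *)
Lemma chain_cover q C : {in C, forall p, nc_le p q} ->
    {in C &, forall p p', nc_le p p' || nc_le p' p} ->
  exists w, [/\ reduced w, wprod w = q & C \subset chain w].
Proof.
elim: {q}(rlen q) {-2}q C (leqnn (rlen q)) => [|k IH] q C qk Cq Cc.
all: have Cq' p : p \in C -> p != q -> rlen p < rlen q.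
1,3: move=> pC; apply: contraNltn => ?; apply/eqP/nc_le_eq; by [exact: Cq|].
- have q1 : q = 1 by apply/eqP; rewrite -rlen_eq0 -leqn0.
  exists [::]; rewrite big_nil /reduced big_nil rlen1 q1; split=> //.
  apply/subsetP=> p pC; rewrite inE -q1.
  by apply: contraLR qk => /(Cq' p pC); rewrite -ltnNge; apply: leq_trans.
have [C0|] := set_0Vmem (C :\ q).
  have [w rw wq] := reduced_wordP q; exists w; split=> //.
  apply/subsetP=> p pC; have : p \notin C :\ q by rewrite C0 inE.
  rewrite !inE pC andbT negbK => /eqP->.
  by apply/chainP; exists [::], w.
case=> p0 p0C; case: (arg_maxnP (@rlen _) p0C) => p pC pmax.
have [|||w [rw wp sw]] := IH p (C :\ q).
- by have [pq pC'] := setD1P pC; have := leq_trans (Cq' p pC' pq) qk.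
- move=> p' p'C; have [_ pC0] := setD1P pC; have [_ p'C0] := setD1P p'C.
  case/orP: (Cc p' p p'C0 pC0) => // le.
  by rewrite (nc_le_eq le (pmax p' p'C)) nc_lexx.
- by move=> a b /setD1P[_ aC] /setD1P[_ bC]; apply: Cc.
have [_ pC0] := setD1P pC.
have := Cq p pC0; rewrite nc_leE => /eqP ql.
have [u /andP[uT /eqP ul] pu] := reduced_wordP (q * p^-1).
have pw : wprod (u ++ w) = q by rewrite big_cat /= pu wp mulgKV.
case/andP: rw => wT /eqP wl.
exists (u ++ w); split=> //.
  by rewrite /reduced all_cat uT wT pw size_cat -ul -wl pu wp addnC ql eqxx.
apply/subsetP=> p' p'C; have [->|p'q] := eqVneq p' q.
  by apply/chainP; exists [::], (u ++ w).
have : p' \in C :\ q by apply/setD1P.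
move/(subsetP sw) => /chainP[a [b [-> ->]]]; apply/chainP; exists (u ++ a), b.
by rewrite catA.
Qed.

Lemma max_chain_word C :
  C \in max_chains n -> exists2 w, factorization w & C = chain w.
Proof.
rewrite inE => /maxsetP[/andP[/subsetP CN /forall_inP Cc] Cmax].
have [||w [rw wc sw]] := @chain_cover c C.
- by move=> p pC; rewrite -NC_E CN.
- by move=> p p' pC p'C; have /forall_inP := Cc p pC; apply.
have fw : factorization w by rewrite /factorization rw wc /=.
by exists w => //; rewrite (Cmax (chain w)) // nc_chain_chain.
Qed.

(** The part of a chain above a given suffix depends only on the product of
that suffix. *)
Lemma chain_catE a u v : wprod u = wprod v ->
  exists H, chain (a ++ u) = H :|: chain u /\ chain (a ++ v) = H :|: chain v.
Proof.
move=> e; elim: a => [|s a [H [H1 H2]]]; first by exists set0; rewrite !set0U.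
exists (wprod ((s :: a) ++ u) |: H); rewrite /= H1 H2 -!setUA; split=> //.
by rewrite !big_cons !big_cat e.
Qed.

(** Two maximal chains that are included in one another are equal, so the two
differences are empty together. *)
Lemma hurwitz_adj_swap (x y : hurwitz_vertex n) p q :
  val x :\: val y \subset [set p] -> val y :\: val x \subset [set q] ->
  x = y \/ hurwitz_adj n x y.
Proof.
move=> sp sq.
have mx (z z' : hurwitz_vertex n) : val z :\: val z' = set0 -> z = z'.
  move/eqP; rewrite setD_eq0 => zz'; apply: val_inj.
  have := valP z; rewrite inE => /maxsetP[_ /(_ (val z'))].
  have := valP z'; rewrite inE => /maxsetP[nc _] /(_ nc zz') //.
have single (z z' : hurwitz_vertex n) r : val z :\: val z' \subset [set r] ->
    z != z' -> #|val z :\: val z'| == 1%N.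
  rewrite subset1 => /orP[/eqP-> | /eqP/mx->]; first by rewrite cards1.
  by rewrite eqxx.
have [->|xy] := eqVneq x y; first by left.
by right; rewrite /hurwitz_adj (single _ _ _ sp) // (single _ _ _ sq) // eq_sym.
Qed.

Lemma moves_path k u v : moves k u v -> forall x : hurwitz_vertex n,
  factorization u -> val x = chain u ->
  exists l,
    [/\ path (hurwitz_adj n) x l, val (last x l) = chain v & size l <= k].
Proof.
elim=> {k u v} [w|a b s t s' t' tT e|j k u v w muv IH1 _ IH2] x fu xu.
- by exists [::].
- have mv := moves_step a b tT e.
  set u := a ++ _ in fu xu mv; set v := _ ++ _ in mv *.
  have fv : factorization v.
    have [sz pv _] := moves_inv mv.
    by move: fu; rewrite /factorization (moves_reduced mv) pv.
  pose y : hurwitz_vertex n := Sub (chain v) (chain_max fv).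
  have [H [uE vE]] := @chain_catE a [:: s, t & b] [:: s', t' & b]
     ltac:(by rewrite !big_cons !mulgA e).
  have pe : wprod [:: s, t & b] = wprod [:: s', t' & b] by rewrite !big_cons !mulgA e.
  case: (@hurwitz_adj_swap x y (wprod (t :: b)) (wprod (t' :: b))).
  + rewrite xu /= uE vE /= -pe; apply/subsetP=> z; rewrite !inE.
    case/andP; rewrite !negb_or => /and4P[/negPf-> /negPf-> _ /negPf->].
    by rewrite orbF.
  + rewrite xu /= uE vE /= -pe; apply/subsetP=> z; rewrite !inE.
    case/andP; rewrite !negb_or => /and4P[/negPf-> /negPf-> _ /negPf->].
    by rewrite orbF.
  + by move=> /(congr1 val) xy; exists [::].
  by move=> xy; exists [:: y]; rewrite /= xy.
have fv : factorization v.
  have [sz pv _] := moves_inv muv.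
  by move: fu; rewrite /factorization (moves_reduced muv) pv.
have [l1 [p1 e1 s1]] := IH1 x fu xu.
have [l2 [p2 e2 s2]] := IH2 _ fv e1.
exists (l1 ++ l2); rewrite cat_path p1 p2 last_cat size_cat; split=> //.
exact: leq_add.
Qed.

End Chains.

(** * Distance in a finite graph *)

Section Distance.
Variables (V : finType) (e : rel V).

Lemma has_walkP x y k :
  reflect (exists l, [/\ path e x l, last x l = y & size l = k]) (has_walk e x y k).
Proof.
apply: (iffP existsP) => [[l /andP[pl /eqP ll]]|[l [pl ll <-]]].
  by exists l; rewrite size_tuple.
by exists (in_tuple l); rewrite /= pl ll eqxx.
Qed.

Lemma gdist_le x l : path e x l -> gdist e x (last x l) <= size l.
Proof.
move=> pl; rewrite leqNgt; apply/negP=> lt.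
have lV : size l < #|V|.
  by apply: leq_trans lt _; rewrite -[X in _ <= X](size_iota 0) find_size.
have := before_find 0 lt; rewrite nth_iota // add0n.
suff -> : has_walk e x (last x l) (size l) by [].
by apply/has_walkP; exists l.
Qed.

(** A simple path has fewer edges than the graph has vertices, hence the length
of a shortest walk is among those that [gdist] inspects. *)
Lemma gdist_path x l : path e x l ->
  exists l',
    [/\ path e x l', last x l' = last x l & size l' = gdist e x (last x l)].
Proof.
move=> pl; set y := last x l.
have hw : has (has_walk e x y) (iota 0 #|V|).
  case: (shortenP pl) @y => l' pl' ul' _; apply/hasP; exists (size l').
    rewrite mem_iota add0n; move: (max_card (mem (x :: l'))).
    by rewrite (card_uniqP ul').
  by apply/has_walkP; exists l'.
have := nth_find 0 hw; rewrite nth_iota; last by move: hw; rewrite has_find size_iota.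
by rewrite add0n => /has_walkP[l' [? ? ?]]; exists l'.
Qed.

End Distance.

(** * The long cycle and the upper bound *)

Section LongCycle.
Variable m : nat.
Notation c := (cycle_perm m.+1).

Lemma cycle_permX k : k <= m -> (c ^+ k) ord0 = inord k.
Proof.
elim: k => [|k IH] km; first by rewrite expg0 perm1; apply: val_inj; rewrite /= inordK.
rewrite expgSr permM IH 1?ltnW // permE; apply: val_inj.
by rewrite /= !inordK ?modn_small // ltnW.
Qed.

Lemma porbit_cycle_perm (i : 'I_m.+1) : i \in porbit c ord0.
Proof.
apply/porbitP; exists i; rewrite cycle_permX //; last by rewrite -ltnS.
by rewrite inord_val.
Qed.

Lemma one_cycle_cycle_perm : one_cycle c.
Proof.
move=> x y _ _; have := porbit_cycle_perm x; have := porbit_cycle_perm y.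
by rewrite -!eq_porbit_mem => /eqP-> /eqP->.
Qed.

Lemma rlen_cycle_perm : rlen c = m.
Proof.
have := rlen_porbits c; rewrite (_ : #|porbits c| = 1%N) ?card_ord.
  by rewrite addn1 => -[].
apply/eqP/cards1P; exists (porbit c ord0); apply/setP=> B.
rewrite inE; apply/imsetP/eqP=> [[i _ ->]|->]; last by exists ord0.
by apply/eqP; rewrite eq_porbit_mem porbit_cycle_perm.
Qed.

Lemma factorization_size (w : seq 'S_m.+1) : factorization w -> size w = m.
Proof. by case/andP=> /andP[_ /eqP<-] /eqP->; apply: rlen_cycle_perm. Qed.

Lemma hurwitz_walk (x y : hurwitz_vertex m.+1) :
  exists l, [/\ path (hurwitz_adj m.+1) x l, last x l = y
              & 4 * size l <= 3 * (m * m.-1)].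
Proof.
have [u fu xu] := max_chain_word (valP x).
have [v fv yv] := max_chain_word (valP y).
have /andP[ru /eqP uc] := fu; have /andP[rv /eqP vc] := fv.
have [||k mk ck] := @moves_bound _ u v _ ru rv.
- by rewrite uc; apply: one_cycle_cycle_perm.
- by rewrite vc.
have [l [pl ll sl]] := moves_path mk fu xu.
exists l; split=> //; first by apply: val_inj; rewrite ll.
rewrite (factorization_size fu) in ck; apply: leq_trans ck; by rewrite leq_mul2l.
Qed.

Lemma gdiam_upper : 4 * gdiam (hurwitz_adj m.+1) <= 3 * (m * m.-1).
Proof.
have H x y : gdist (hurwitz_adj m.+1) x y <= (3 * (m * m.-1)) %/ 4.
  have [l [pl <- sl]] := hurwitz_walk x y.
  by apply: leq_trans (gdist_le pl) _; rewrite leq_divRL // mulnC.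
rewrite mulnC -leq_divRL //.
by apply/bigmax_leqP=> x _; apply/bigmax_leqP=> y _.
Qed.

End LongCycle.

(** * Inversions of a maximal chain *)

Section NonMinima.
Variable m : nat.
Notation n := m.+1.
Notation c := (cycle_perm n).
Implicit Types (p q s t : 'S_n) (u v w a b : seq 'S_n).
Implicit Types (C D : {set 'S_n}) (i j : 'I_n).

(** The least elements of the cycles represent them, so the reflection
length counts the remaining points. *)
Definition nonmin p :=
  [set i : 'I_n | [exists j : 'I_n, (j < i) && (j \in porbit p i)]].

Lemma card_nonmin p : #|nonmin p| = rlen p.
Proof.
have inj : {in ~: nonmin p &, injective (porbit p)}.
  move=> i j; rewrite !inE => /existsPn hi /existsPn hj e.
  apply: val_inj => /=; case: (ltngtP i j) => // lt.
    by have := hj i; rewrite lt -e porbit_id.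
  by have := hi j; rewrite lt e porbit_id.
have im : porbit p @: (~: nonmin p) = porbits p.
  apply/eqP; rewrite eqEsubset; apply/andP; split.
    by apply/subsetP=> B /imsetP[i _ ->]; apply: imset_f.
  apply/subsetP=> B /imsetP[i _ ->]; case: (arg_minnP val (porbit_id p i)) => j ji jmin.
  have e : porbit p i = porbit p j by apply/eqP; rewrite eq_porbit_mem porbit_sym.
  rewrite e; apply: imset_f; rewrite !inE; apply/existsPn=> k; rewrite -e.
  by apply/negP=> /andP[kj /jmin]; rewrite leqNgt kj.
have := cardsC (nonmin p); have := rlen_porbits p; rewrite -im card_in_imset //.
by move=> <- /eqP; rewrite eqn_add2r => /eqP.
Qed.

Lemma nonmin1 : nonmin 1 = set0.
Proof. by apply/eqP; rewrite -cards_eq0 card_nonmin rlen1. Qed.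

Lemma porbit_sub p q : (forall i, p i \in porbit q i) ->
  forall i j, j \in porbit p i -> j \in porbit q i.
Proof.
move=> h i j /porbitP[k ->]; elim: k => [|k IH]; first by rewrite perm1 porbit_id.
rewrite expgSr permM; have := h ((p ^+ k) i); move: IH.
by rewrite -!eq_porbit_mem => /eqP->.
Qed.

(** In a reduced word each letter glues two cycles of the product of the letters
after it, so the cycles only grow. *)
Lemma reduced_porbit u v i j : reduced (u ++ v) ->
  j \in porbit (wprod v) i -> j \in porbit (wprod (u ++ v)) i.
Proof.
elim: u => //= t u IH r jv; have [_ r'] := reduced_cat (u := [::_]) r.
apply: porbit_sub (IH r' jv) => k; rewrite big_cons.
case/andP: r => /andP[tT _] /eqP /=; case/andP: r' => _ /eqP <-.
rewrite big_cons; set p := \prod_(_ <- _) _; case/is_tpermP: tT => x [y [xy ->]] len.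
have xy_in : x \in porbit (tperm x y * p) y.
  have := rlen_tpermM (tperm x y * p) xy; rewrite tpermKg len.
  by case: (x \in _) => //=; move: (rlen _); lia.
have -> : p k = (tperm x y * p) (tperm x y k) by rewrite permM tpermK.
suff : tperm x y k \in porbit (tperm x y * p) k.
  rewrite -!eq_porbit_mem => /eqP <-; rewrite eq_porbit_mem; exact: perm_porbit.
by case: tpermP => [->|->|_ _]; rewrite ?porbit_id // porbit_sym.
Qed.

Lemma nonmin_mono p q : nc_le p q -> nonmin p \subset nonmin q.
Proof.
case/nc_leP=> u [v [r <- <-]]; apply/subsetP=> i; rewrite !inE.
case/existsP=> j /andP[ji jp]; apply/existsP; exists j; rewrite ji.
exact: reduced_porbit.
Qed.

(** Along C the points enter [nonmin] one by one; a pair is inverted when the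
larger point enters first. The point 0 never enters and is left out. *)
Definition inversions C := [set ij : 'I_n * 'I_n | [&& 0 < ij.1, ij.1 < ij.2 &
  [exists p in C, (ij.2 \in nonmin p) && (ij.1 \notin nonmin p)]]].

Lemma inversionsP C (ij : 'I_n * 'I_n) : reflect
  [/\ 0 < ij.1, ij.1 < ij.2
    & exists2 p, p \in C & ij.2 \in nonmin p /\ ij.1 \notin nonmin p]
  (ij \in inversions C).
Proof.
rewrite in_set; apply: (iffP and3P) => [[i0 ij' /exists_inP[p pC /andP[p2 p1]]]|].
  by split=> //; exists p.
by case=> i0 ij' [p pC [p2 p1]]; split=> //; apply/exists_inP; exists p; rewrite // p2.
Qed.

Lemma nonmin_cycle_perm i : 0 < i -> i \in nonmin c.
Proof.
move=> i0; rewrite inE; apply/existsP; exists ord0; rewrite i0.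
by rewrite porbit_sym porbit_cycle_perm.
Qed.

Lemma rlen_consS s v :
  reduced (s :: v) -> rlen (wprod (s :: v)) = (rlen (wprod v)).+1.
Proof.
move=> r; have [_ /andP[_ /eqP->]] := reduced_cat (u := [::_]) r.
by case/andP: r => _ /eqP.
Qed.

(** Only p can witness an inversion that D lacks. The neighbours of p in C
belong to D and witness nothing, so the larger point of the pair is the one
that enters at p, and the smaller one enters at the next element of C: the pair
is determined. *)
Lemma card_inversionsD C D p : C \in max_chains n -> C :\: D = [set p] ->
  #|inversions C :\: inversions D| <= 1.
Proof.
move=> Cmax CD; have [w fw CE] := max_chain_word Cmax.
have /setDP[pC _] : p \in C :\: D by rewrite CD inE.
have inD q : q \in C -> q != p -> q \in D.
  move=> qC qp; apply: contraNT qp => qD; rewrite -in_set1 -CD inE.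
  by rewrite qD.
have witness (ij : 'I_n * 'I_n) : ij \in inversions C :\: inversions D ->
    [/\ 0 < ij.1, ij.2 \in nonmin p, ij.1 \notin nonmin p &
     forall q, q \in D -> ij.2 \in nonmin q -> ij.1 \in nonmin q].
  case/setDP=> /inversionsP[i0 ij' [q qC [q2 q1]]] /inversionsP nD.
  have none r : r \in D -> ij.2 \in nonmin r -> ij.1 \in nonmin r.
    by move=> rD r2; apply: contra_notT nD => r1; split=> //; exists r.
  have [<-|qp] := eqVneq q p; first by [].
  by have := none q (inD q qC qp) q2; rewrite (negPf q1).
have := pC; rewrite {1}CE => /chainP[a [b [wE pE]]].
have /andP[rw /eqP wc] := fw.
rewrite leqNgt; apply/negP=> /card_gt1P[ij [ij' [h h' ne]]].
have [i0 b2 b1 bD] := witness _ h; have [i0' b2' b1' bD'] := witness _ h'.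
(* The ends of the chain witness nothing: [nonmin] is empty for the identity
   and contains every point but 0 for the long cycle. So p is not an end. *)
case: b wE pE => [|t b] wE pE.
  by move: b2; rewrite pE big_nil nonmin1 inE.
case/lastP: a wE => [|a s] wE.
  by move: b1; rewrite pE -[t :: b]/([::] ++ t :: b) -wE wc nonmin_cycle_perm.
rewrite cat_rcons in wE; rewrite wE in rw.
have [_ r1] := reduced_cat rw; have [_ r2] := reduced_cat (u := [:: s]) r1.
have [_ r3] := reduced_cat (u := [:: t]) r2.
set lo := wprod b; set hi := wprod [:: s, t & b].
have lens : rlen p = (rlen lo).+1 /\ rlen hi = (rlen p).+1.
  by rewrite pE /lo /hi !rlen_consS.
have loD : lo \in D.
  apply: inD; last by apply/eqP=> e; case: lens; rewrite e => /n_Sn.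
  by rewrite CE; apply/chainP; exists (a ++ [:: s; t]), b; rewrite wE -catA.
have hiD : hi \in D.
  apply: inD; last by apply/eqP=> e; case: lens; rewrite e => _ /n_Sn.
  by rewrite CE; apply/chainP; exists a, [:: s, t & b].
have lop : nonmin lo \subset nonmin p.
  by apply: nonmin_mono; rewrite pE; apply: (@nc_le_suffix _ [:: t]).
have phi : nonmin p \subset nonmin hi.
  by apply: nonmin_mono; rewrite pE; apply: (@nc_le_suffix _ [:: s]).
have single (A B : {set 'I_n}) i j : A \subset B -> #|B| = #|A|.+1 ->
    i \in B -> i \notin A -> j \in B -> j \notin A -> i = j.
  move=> sAB cB iB iA jB jA.
  have : #|B :\: A| <= 1 by rewrite cardsD (setIidPr sAB) cB subSnn.
  by move/card_le1_eqP; apply; rewrite inE ?iA ?jA.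
case/eqP: ne; rewrite [ij]surjective_pairing [ij']surjective_pairing; congr (_, _).
  apply: (single _ _ _ _ phi); rewrite ?card_nonmin //; first by case: lens.
    by apply: bD; rewrite // (subsetP phi).
  by apply: bD'; rewrite // (subsetP phi).
apply: (single _ _ _ _ lop); rewrite ?card_nonmin //; first by case: lens.
  by apply: contra b1 => /(bD _ loD); apply: (subsetP lop).
by apply: contra b1' => /(bD' _ loD); apply: (subsetP lop).
Qed.

Lemma inversions_adj (x y : hurwitz_vertex n) : hurwitz_adj n x y ->
  #|inversions (val y)| <= #|inversions (val x)|.+1.
Proof.
case/andP=> _ /cards1P[p /(card_inversionsD (valP y))].
rewrite cardsD leq_subLR addn1 => /leq_trans; apply.
by rewrite ltnS subset_leq_card ?subsetIr.
Qed.

Lemma inversions_path (x : hurwitz_vertex n) l : path (hurwitz_adj n) x l ->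
  #|inversions (val (last x l))| <= #|inversions (val x)| + size l.
Proof.
elim: l x => [|y l IH] x /=; first by rewrite addn0.
case/andP=> /inversions_adj xy /IH /leq_trans; apply.
by rewrite addnS -addSn leq_add2r.
Qed.

End NonMinima.

(** * Two distant chains *)

Section Extremal.
Variable m : nat.
Notation n := m.+1.
Notation c := (cycle_perm n).
Implicit Types (p q s t : 'S_n) (u v w a b : seq 'S_n) (i j : 'I_n).

(** The cycle (lo, lo + 1, ..., hi), given by its values so as to be stated for
natural numbers lo and hi. *)
Definition interval_cycle lo hi p := forall i : 'I_n,
  p i = (if lo <= i < hi then i.+1 else if i == hi :> nat then lo else i) :> nat.

Lemma interval_cycle_inj lo hi p q :
  interval_cycle lo hi p -> interval_cycle lo hi q -> p = q.
Proof. by move=> hp hq; apply/permP=> i; apply: val_inj; rewrite /= hp hq. Qed.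

Lemma interval_cycle1 k : interval_cycle k k 1.
Proof. by move=> i; rewrite perm1; case: ifP; [lia | case: eqP]. Qed.

Lemma interval_cycle_full : interval_cycle 0 m c.
Proof.
move=> i; rewrite permE /=; have := ltn_ord i; rewrite ltnS leq_eqVlt.
by case/orP=> [/eqP->|im]; rewrite ?modnn ?ltnn ?eqxx // im modn_small.
Qed.

Lemma nonmin_interval lo hi p i :
  lo <= hi -> hi <= m -> interval_cycle lo hi p ->
  (i \in nonmin p) = (lo < i <= hi).
Proof.
move=> lohi him hp.
have fixed (j : 'I_n) : (j < lo) || (hi < j) -> porbit p j = [set j].
  move=> hj; apply: porbit_fix; apply: val_inj; rewrite /= hp.
  by case: ifP; [lia | case: eqP; lia].
rewrite inE; apply/existsP/idP=> [[j /andP[ji jp]]|/andP[loi ihi]].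
  apply: contraLR ji; rewrite -leqNgt => hi_i.
  have [il|il] := eqVneq (i : nat) lo; last first.
    have := jp; rewrite fixed; last by lia.
    by rewrite inE => /eqP->.
  rewrite il leqNgt; apply/negP=> jlo; have := jp.
  by rewrite porbit_sym fixed ?jlo // inE => /eqP e; move: jlo; rewrite -il e ltnn.
have jm : i.-1 < n by have := ltn_ord i; lia.
exists (Ordinal jm); rewrite /=; apply/andP; split; first lia.
suff e : p (Ordinal jm) = i.
  by have := perm_porbit p (Ordinal jm); rewrite e porbit_sym.
by apply: val_inj; rewrite /= hp /=; case: ifP; lia.
Qed.

(** The word (k-1 k) ... (1 2) (0 1), whose suffixes multiply to the cycles on
initial segments. *)
Fixpoint up_word k : seq 'S_n :=
  if k is k'.+1 then tperm (inord k') (inord k) :: up_word k' else [::].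

(** The word (m-k m) ... (m-2 m) (m-1 m), whose suffixes multiply to the cycles
on final segments. *)
Fixpoint down_word k : seq 'S_n :=
  if k is k'.+1 then tperm (inord (m - k)) ord_max :: down_word k' else [::].

Lemma up_word_cycle k : k <= m -> interval_cycle 0 k (wprod (up_word k)).
Proof.
elim: k => [|k IH] km /=; first by rewrite big_nil; apply: interval_cycle1.
rewrite big_cons => i; rewrite permM (IH (ltnW km)).
have ek : (inord k : 'I_n) = k :> nat by rewrite inordK //; lia.
have ek1 : (inord k.+1 : 'I_n) = k.+1 :> nat by rewrite inordK //; lia.
case: tpermP => [->|->|/eqP ne1 /eqP ne2]; rewrite ?ek ?ek1.
- by do !case: ifP; lia.
- by do !case: ifP; lia.
- by rewrite -!val_eqE /= ek ek1 in ne1 ne2; do !case: ifP; lia.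
Qed.

Lemma down_word_cycle k :
  k <= m -> interval_cycle (m - k) m (wprod (down_word k)).
Proof.
elim: k => [|k IH] km /=.
  by rewrite big_nil subn0; apply: interval_cycle1.
rewrite big_cons => i; rewrite permM (IH (ltnW km)).
have ek : (inord (m - k.+1) : 'I_n) = m - k.+1 :> nat by rewrite inordK //; lia.
have im := ltn_ord i.
case: tpermP => [->|->|/eqP ne1 /eqP ne2]; rewrite ?ek /=.
- by do !case: ifP; lia.
- by do !case: ifP; lia.
- by rewrite -!val_eqE /= ek in ne1 ne2; do !case: ifP; lia.
Qed.

Lemma size_up_word k : size (up_word k) = k.
Proof. by elim: k => //= k ->. Qed.

Lemma up_word_tperm k : k <= m -> all (@is_tperm _) (up_word k).
Proof.
elim: k => //= k IH km; rewrite IH 1?ltnW // andbT is_tperm_tperm //.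
by rewrite -val_eqE /= !inordK //; lia.
Qed.

Lemma size_down_word k : size (down_word k) = k.
Proof. by elim: k => //= k ->. Qed.

Lemma down_word_tperm k : k <= m -> all (@is_tperm _) (down_word k).
Proof.
elim: k => //= k IH km; rewrite IH 1?ltnW // andbT is_tperm_tperm //.
by rewrite -val_eqE /= !inordK //; lia.
Qed.

Lemma factorization_interval w : all (@is_tperm _) w -> size w = m ->
  interval_cycle 0 m (wprod w) -> factorization w.
Proof.
move=> wT ws /interval_cycle_inj/(_ interval_cycle_full) wc.
by rewrite /factorization /reduced wT wc rlen_cycle_perm ws !eqxx.
Qed.

Lemma up_factorization : factorization (up_word m).
Proof.
apply: factorization_interval; last exact: up_word_cycle.
  exact: up_word_tperm.
exact: size_up_word.
Qed.

Lemma down_factorization : factorization (down_word m).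
Proof.
apply: factorization_interval; last by rewrite -{1}(subnn m); apply: down_word_cycle.
  exact: down_word_tperm.
exact: size_down_word.
Qed.

Lemma chain_up k p : k <= m -> p \in chain (up_word k) ->
  exists2 l, l <= m & interval_cycle 0 l p.
Proof.
elim: k => [|k IH] km /=.
  by rewrite inE => /eqP->; exists 0 => //; apply: interval_cycle1.
rewrite inE => /orP[/set1P->|/(IH (ltnW km))//].
by exists k.+1 => //; apply: (@up_word_cycle k.+1).
Qed.

Lemma chain_down k l : l <= k -> wprod (down_word l) \in chain (down_word k).
Proof.
elim: k => [|k IH]; first by rewrite leqn0 => /eqP->; rewrite inE big_nil.
by rewrite leq_eqVlt => /orP[/eqP->|/IH h]; rewrite in_setU1 ?eqxx // h orbT.
Qed.

(** The non-minima of the cycle on {0, ..., l} are 1, ..., l, so the points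
enter in increasing order. *)
Lemma inversions_up : inversions (chain (up_word m)) = set0.
Proof.
apply/eqP; rewrite -subset0; apply/subsetP=> ij /inversionsP[i0 ij' [p pC [p2 p1]]].
have [l lm hp] := chain_up (leqnn m) pC.
by move: p2 p1; rewrite !(nonmin_interval _ _ _ hp) //; lia.
Qed.

(** The cycle on {i, ..., m} is a witness for every pair (i, j): i is its least
element and j is not. *)
Lemma inversions_down (ij : 'I_n * 'I_n) : 0 < ij.1 < ij.2 ->
  ij \in inversions (chain (down_word m)).
Proof.
case/andP=> i0 lt; apply/inversionsP; split=> //.
have jm := ltn_ord ij.2.
exists (wprod (down_word (m - ij.1))); first by apply: chain_down; apply: leq_subr.
have hp := @down_word_cycle (m - ij.1) (leq_subr _ _).
by split; rewrite (nonmin_interval _ _ _ hp) //; lia.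
Qed.

Lemma sum_ltn k l : \sum_(i < k) (i < l) = minn l k.
Proof.
elim: k => [|k IH]; first by rewrite big_ord0 minn0.
by rewrite big_ord_recr /= IH; case: ltnP; lia.
Qed.

Lemma card_pairs : #|[set ij : 'I_n * 'I_n | 0 < ij.1 < ij.2]| = 'C(m, 2).
Proof.
rewrite -sum1_card.
rewrite (eq_bigl (fun ij : 'I_n * 'I_n => 0 < ij.1 < ij.2)); last first.
  by move=> ij; rewrite inE.
pose f i j : nat := if 0 < i < j then 1%N else 0%N.
rewrite big_mkcond -(pair_bigA _ f) /= /f.
rewrite big_ord_recl /= [X in X + _]big1 // add0n exchange_big /=.
rewrite big_ord_recl /= [X in X + _]big1 // add0n.
rewrite -bin2_sum big_mkord; apply: eq_bigr => j _.
rewrite -[RHS](minn_idPl (ltnW (ltn_ord j))) -sum_ltn; apply: eq_bigr => i _.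
by rewrite /bump /= !add1n ltnS; case: ltnP.
Qed.

Lemma gdiam_lower : 'C(m, 2) <= gdiam (hurwitz_adj n).
Proof.
pose x : hurwitz_vertex n := Sub (chain (up_word m)) (chain_max up_factorization).
pose y : hurwitz_vertex n := Sub (chain (down_word m)) (chain_max down_factorization).
have [l [pl ly _]] := hurwitz_walk x y.
have [l' [pl' ll' sl']] := gdist_path pl.
apply: leq_trans (_ : gdist (hurwitz_adj n) x y <= _); last first.
  by apply: leq_trans (leq_bigmax x); apply: leq_bigmax.
have := inversions_path pl'; rewrite ll' ly inversions_up cards0 add0n sl' ly.
apply: leq_trans; rewrite -card_pairs; apply: subset_leq_card.
by apply/subsetP=> ij; rewrite inE => /inversions_down.
Qed.

End Extremal.

(** * The diameter *)

Import GRing.Theory Num.Theory.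

Local Open Scope ring_scope.

Theorem proposition10p5 (n : nat) (hn : (1 <= n)%N) :
  ('C(n - 1, 2) <= gdiam (hurwitz_adj n))%N /\
  (gdiam (hurwitz_adj n))%:R <= 3%:R / 2%:R * ('C(n - 1, 2))%:R :> rat.
Proof.
case: n hn => // m _; rewrite subn1 /=; split; first exact: gdiam_lower.
have := gdiam_upper m; rewrite -[X in (X * m.-1)%N]/m.
have := mul_bin_diag m 1; rewrite bin1 => ->.
move: (gdiam _) 'C(m, 2) => d b h.
rewrite mulrAC ler_pdivlMr ?ltr0n // -!natrM ler_nat.
by lia.
Qed.
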